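(* Let $n\in\mathbb{N}$ and let $A\in U(n)$ be a unitary matrix. Then $A$ has a biunimodular vector $v$ if and only if $$A=\operatorname{diag}(w_1,\dots,w_n)\,F_n\begin{bmatrix}1&0\\0&B\end{bmatrix}F_n^*\,\operatorname{diag}(\overline{v_1},\dots,\overline{v_n}),$$ where $v=(v_1,\dots,v_n)\in\mathbb{T}^n$, $Av=w=(w_1,\dots,w_n)\in\mathbb{T}^n$, and $B$ is some unitary matrix in $U(n-1)$.
   Context: $\mathbb{T}=\{z\in\mathbb{C}:|z|=1\}$. A biunimodular vector for $A\in U(n)$ is a vector $v\in\mathbb{C}^n$ such that both $v$ and $Av$ have all entries of modulus one. $F_n\in U(n)$ is the Fourier matrix $(F_n)_{j,k}=\frac{1}{\sqrt n}e^{-2\pi i jk/n}$, $j,k=0,\dots,n-1$, and $F_n^*$ is its conjugate transpose. The middle matrix is block diagonal with a $1\times1$ block $1$ and an $(n-1)\times(n-1)$ block $B$. *)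

(* Defs.v *)
From HB Require Import structures.
From mathcomp Require Import all_boot all_order all_algebra.
From mathcomp Require Import spectral.
From mathcomp Require Import complex.
From mathcomp Require Import reals trigo.

Set Implicit Arguments.
Unset Strict Implicit.
Unset Printing Implicit Defensive.

Import Order.TTheory GRing.Theory Num.Theory.

Local Open Scope ring_scope.
Local Open Scope complex_scope.
Local Open Scope sesquilinear_scope.

(* Vectors are columns.  The norm of R[i] takes its values in R[i]. *)
Definition unimodular (R : realType) (n : nat) (v : 'cV[R[i]]_n) : Prop :=
  forall j : 'I_n, `|v j 0| = 1.

Definition biunimodular (R : realType) (n : nat) (A : 'M[R[i]]_n)
  (v : 'cV[R[i]]_n) : Prop := unimodular v /\ unimodular (A *m v).

(* e^(i t), by Euler's formula *)
Definition expi (R : realType) (t : R) : R[i] := cos t +i* sin t.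

Definition Fourier (R : realType) (n : nat) : 'M[R[i]]_n :=
  \matrix_(j < n, k < n)
    ((Num.sqrt n%:R)^-1%:C * expi (- (2 * pi * (j * k)%:R / n%:R))).

(* The right-hand side of the factorization of a matrix of size n.+1.  Since
   the row vector (v^t* ) is the conjugate transpose of the column v, the
   diagonal of the last factor consists of the conjugates of the entries of v. *)
Definition fourier_form (R : realType) (n : nat) (w v : 'cV[R[i]]_n.+1)
  (B : 'M[R[i]]_n) : 'M[R[i]]_n.+1 :=
  diag_mx w^T *m Fourier R n.+1
    *m (block_mx (1%:M : 'M_1) 0 0 B : 'M[R[i]]_(1 + n))
    *m (Fourier R n.+1) ^t* *m diag_mx (v ^t*).

(* Main.v *)
(** The diagonal matrices and [F_n] are unitary, and [F_n] maps the first basis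
    vector [e_0] to a multiple of the all-ones vector.  Conjugating,
    [A v = w] says exactly that [F_n^* diag(w)^* A diag(v) F_n] fixes [e_0];
    a unitary matrix fixing [e_0] also has first row [e_0^T], because its adjoint
    fixes [e_0] too, so it is block diagonal. *)
Require Import Defs.
From mathcomp Require Import all_boot all_order all_algebra.
From mathcomp Require Import spectral.
From mathcomp Require Import complex.
From mathcomp Require Import reals trigo.
From mathcomp Require Import ring lra.

Set Implicit Arguments.
Unset Strict Implicit.
Unset Printing Implicit Defensive.

Import Order.TTheory GRing.Theory Num.Theory.

Local Open Scope ring_scope.
Local Open Scope complex_scope.
Local Open Scope sesquilinear_scope.

Section Expi.
Variable R : realType.
Implicit Types x y : R.

Lemma expi0 : expi 0 = 1 :> R[i].
Proof. by rewrite /expi cos0 sin0. Qed.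

Lemma expiD x y : expi (x + y) = expi x * expi y.
Proof.
rewrite /expi cosD sinD; apply/eqP; rewrite eq_complex /=.
by apply/andP; split; apply/eqP; ring.
Qed.

Lemma expiN x : expi (- x) = (expi x)^*%C.
Proof. by rewrite /expi cosN sinN. Qed.

Lemma expiMn x k : expi (x *+ k) = expi x ^+ k.
Proof.
by elim: k => [|k IHk]; rewrite ?mulr0n ?expi0 // mulrS expiD IHk exprS.
Qed.

Lemma expi2pi : expi (pi *+ 2) = 1 :> R[i].
Proof. by rewrite /expi cos2pi sin2pi. Qed.

(** The real part already differs from 1: cosine is even, so it equals 1 - 2 sin^2(|x|/2), and |x|/2
    lies strictly between 0 and pi, where sine is positive. *)
Lemma expi_neq1 x : 0 < `|x| < pi *+ 2 -> expi x != 1.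
Proof.
move=> /andP[x0 x2]; rewrite eq_complex /= negb_and; apply/orP; left.
have -> : cos x = cos ((`|x| / 2) *+ 2).
  rewrite -mulr_natr divfK ?pnatr_eq0 //.
  by case: (ger0P x) => // _; rewrite cosN.
have sy : 0 < sin (`|x| / 2).
  by apply: sin_gt0_pi; rewrite divr_gt0 //= ltr_pdivrMr // mulr_natr.
rewrite cos_mulr2n cos2sin2; apply/eqP => c1.
by have := exprn_gt0 2 sy; lra.
Qed.

(** A geometric sum of ratio z = [expi x]: multiplied by z - 1 it becomes z^n - 1 = 0. *)
Lemma sum_expi_root n x : expi (x *+ n) = 1 -> expi x != 1 ->
  \sum_(l < n) expi (x *+ l) = 0.
Proof.
move=> xn x1; under eq_bigr do rewrite expiMn.
apply: (mulfI (x := expi x - 1)); first by rewrite subr_eq0.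
by rewrite -subrX1 -expiMn xn subrr mulr0.
Qed.

End Expi.

Section Fourier.
Variables (R : realType) (n : nat).
Let s : R[i] := (Num.sqrt n.+1%:R)^-1%:C.

(** With N = n + 1, the entry (j, k) of F F^* is 1/N times the geometric sum of ratio exp(2 pi i (k
    - j) / N). This ratio is an N-th root of unity, and it is 1 only for j = k because |k - j| <
    N. *)
Lemma Fourier_unitary : Fourier R n.+1 \is unitarymx.
Proof.
have N0 : n.+1%:R != 0 :> R by rewrite pnatr_eq0.
have conjcM (a b : R[i]) : (a * b)^*%C = a^*%C * b^*%C by rewrite rmorphM.
have realcM (a b : R) : (a * b)%:C = a%:C * b%:C by rewrite rmorphM.
apply/unitarymxP/matrixP => j k; rewrite !mxE.
pose x : R := 2 * pi * (k%:R - j%:R) / n.+1%:R.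
have -> : \sum_l Fourier R n.+1 j l * (Fourier R n.+1) ^t* l k
    = n.+1%:R^-1%:C * \sum_(l < n.+1) expi (x *+ l).
  rewrite mulr_sumr; apply: eq_bigr => l _; rewrite !mxE.
  rewrite -[X in _ * X]/((_ * _)^*%C) conjcM conjc_real -expiN opprK.
  rewrite mulrACA -expiD -realcM -invfM -expr2 sqr_sqrtr ?ler0n //.
  rewrite /x !natrM; congr (_ * expi _).
  by rewrite -mulr_natr; field; rewrite -mulrS.
have [jk|jk] := eqVneq j k.
  under eq_bigr do rewrite /x jk subrr mulr0 mul0r mul0rn expi0.
  by rewrite sumr_const card_ord -(rmorph_nat (real_complex R)) -rmorphM /= mulVf.
rewrite sum_expi_root ?mulr0 //.
  (* Since k - j may be negative, the total angle is split into two natural multiples of 2 pi. *)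
  have -> : x *+ n.+1 = pi *+ 2 *+ k - pi *+ 2 *+ j.
    rewrite /x -mulr_natr -!(mulr_natr (pi *+ 2)) -(mulr_natr pi).
    by field; rewrite -mulrS.
  by rewrite expiD expiN !(expiMn (pi *+ 2)) expi2pi !expr1n rmorph1 mulr1.
have jk0 : (k%:R - j%:R : R) != 0 by rewrite subr_eq0 eqr_nat eq_sym.
have pi_neq0 : pi != 0 :> R by rewrite gt_eqF ?pi_gt0.
apply: expi_neq1; rewrite normr_gt0 !mulf_neq0 ?invr_neq0 ?pnatr_eq0 //=.
rewrite /x !normrM normfV !normr_nat (gtr0_norm (pi_gt0 R)) ltr_pdivrMr ?ltr0n //.
rewrite -[pi *+ 2]mulr_natl ltr_pM2l ?mulr_gt0 ?pi_gt0 // ltr_norml.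
have := ltn_ord j; have := ltn_ord k; rewrite -!(ltr_nat R).
have := ler0n R j; have := ler0n R k; lra.
Qed.

Lemma Fourier_delta : Fourier R n.+1 *m delta_mx 0 0 = s *: const_mx 1 :> 'cV_n.+1.
Proof.
by apply/matrixP => j k; rewrite ord1 -colE !mxE muln0 mulr0 mul0r oppr0 expi0.
Qed.

Lemma Fourier_scale_neq0 : s != 0.
Proof. by rewrite /s (fmorph_eq0 (real_complex R)) invr_eq0 gt_eqF // sqrtr_gt0. Qed.

End Fourier.

Section Unitary.
Variable K : numClosedFieldType.

Lemma unitarymx_adjoint_mul n (U : 'M[K]_n) : U \is unitarymx -> U ^t* *m U = 1%:M.
Proof.
by rewrite -trmxC_unitary => /unitarymxP; rewrite trmxCK.
Qed.

Lemma unitary_block1 n (B : 'M[K]_n) :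
  ((block_mx (1%:M : 'M_1) 0 0 B : 'M_(1 + n)) \is unitarymx)
  = (B \is unitarymx).
Proof.
apply/unitarymxP/unitarymxP.
  rewrite tr_block_mx map_block_mx mulmx_block !trmx0 !map_mx0 !mulmx0 !mul0mx.
  by rewrite !add0r scalar_mx_block => /eq_block_mx[].
rewrite tr_block_mx map_block_mx mulmx_block !trmx0 !map_mx0 !mulmx0 !mul0mx.
by move=> ->; rewrite trmx1 map_mx1 mulmx1 !addr0 add0r scalar_mx_block.
Qed.

(** Puts e_0 in the form on which block products compute. *)
Lemma delta_col_mx n : delta_mx 0 0 = col_mx 1%:M 0 :> 'cV[K]_(1 + n).
Proof.
apply/matrixP => i j; rewrite !ord1 !mxE /=; case: splitP => k ik.
  by rewrite ord1 in ik *; rewrite mxE -val_eqE /= ik.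
by rewrite mxE -val_eqE /= ik.
Qed.

Lemma unitary_fix_delta n (C : 'M[K]_(1 + n)) : C \is unitarymx ->
  C *m delta_mx 0 0 = delta_mx 0 0 :> 'cV_(1 + n) ->
  exists2 B : 'M_n, B \is unitarymx & C = block_mx 1%:M 0 0 B.
Proof.
rewrite delta_col_mx => UC Ce; have Ce' : C ^t* *m col_mx 1%:M 0 = col_mx 1%:M 0 :> 'cV_(1 + n).
  by rewrite -{1}Ce mulmxA unitarymx_adjoint_mul // mul1mx.
move: UC Ce Ce'; rewrite -(submxK C) tr_block_mx map_block_mx !mul_block_col.
rewrite !mulmx1 !mulmx0 !addr0 => UC /eq_col_mx[ul dl] /eq_col_mx[_ ur].
(* The lower part of C^* e_0 is the adjoint of the upper right block of C. *)
have {}ur : ursubmx C = 0.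
  by rewrite -[ursubmx C]trmxCK ur trmx0 map_mx0.
rewrite ul dl ur in UC *.
by exists (drsubmx C); rewrite ?unitary_block1 // in UC *.
Qed.

Lemma unimodular_diag_unitary n (v : 'cV[K]_n) :
  (forall j, `|v j 0| = 1) -> diag_mx v^T \is unitarymx.
Proof.
move=> v1; apply/unitarymxP; rewrite tr_diag_mx map_diag_mx mulmx_diag.
rewrite -diag_const_mx; congr diag_mx; apply/rowP => j.
by rewrite !mxE -normCK v1 expr1n.
Qed.

(** Links [v] and [w] to the all-ones vector, which is where F sends e_0 up to scale. *)
Lemma diag_const1 n (v : 'cV[K]_n) : diag_mx v^T *m const_mx 1 = v.
Proof. by apply/matrixP => i j; rewrite mul_diag_mx !mxE mulr1 ord1. Qed.

End Unitary.

Theorem proposition3p1 (R : realType) (n : nat) (A : 'M[R[i]]_n.+1)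
  (hA : A \is unitarymx) :
  ((exists v : 'cV[R[i]]_n.+1, biunimodular A v) <->
   (exists (v w : 'cV[R[i]]_n.+1) (B : 'M[R[i]]_n),
      [/\ unimodular v, unimodular w, A *m v = w, B \is unitarymx
        & A = fourier_form w v B]))
  /\
  (forall v w : 'cV[R[i]]_n.+1, unimodular v -> unimodular w ->
     (A *m v = w <->
      exists2 B : 'M[R[i]]_n, B \is unitarymx & A = fourier_form w v B)).
Proof.
(* The existence statement follows from the pointwise one with w := A v. *)
suff H (v w : 'cV[R[i]]_n.+1) : unimodular v -> unimodular w ->
     (A *m v = w <->
      exists2 B : 'M[R[i]]_n, B \is unitarymx & A = fourier_form w v B).
  split=> //; split=> [[v [v1 w1]]|[v [w [B [v1 w1 Avw _ _]]]]].
    have [B UB AB] := (H v (A *m v) v1 w1).1 erefl.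
    by exists v, (A *m v), B.
  by exists v; rewrite /biunimodular Avw.
move=> v1 w1; rewrite /fourier_form.
(* F is now abstracted to a unitary matrix with F e_0 = s 1 and s != 0, where 1 is the all-ones
   vector; the diagonal factors are then abstracted likewise. *)
have UF := Fourier_unitary R n; have Fe := Fourier_delta R n.
have s0 := Fourier_scale_neq0 R n.
move: (Fourier R n.+1) (_^-1%:C) UF Fe s0 => F s UF Fe s0.
have Udv := unimodular_diag_unitary v1; have Udw := unimodular_diag_unitary w1.
have dvE : diag_mx (v ^t*) = (diag_mx v^T) ^t* by rewrite tr_diag_mx map_diag_mx.
rewrite dvE; have vE := diag_const1 v; have wE := diag_const1 w.
move: (diag_mx v^T) (diag_mx w^T) Udv Udw vE wE => V W UV UW vE wE.
have F1 : F ^t* *m const_mx 1 = s^-1 *: delta_mx 0 0 :> 'cV_n.+1.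
  apply: (scalerI s0); rewrite scalerA divff // scale1r scalemxAr -Fe mulmxA.
  by rewrite unitarymx_adjoint_mul // mul1mx.
split=> [Avw|[B _ ->]]; last first.
  (* Following v through the factors: V^* v = 1, F^* 1 = s^-1 e_0, the block matrix fixes e_0, F e_0
     = s 1, and W 1 = w. *)
  rewrite -!mulmxA -[in X in V ^t* *m X]vE [V ^t* *m _]mulmxA.
  rewrite unitarymx_adjoint_mul // mul1mx F1 -!scalemxAr.
  have -> : (block_mx (1%:M : 'M_1) 0 0 B : 'M_(1 + n)) *m delta_mx 0 0
      = delta_mx 0 0 :> 'cV_(1 + n).
    by rewrite delta_col_mx mul_block_col !mul1mx !mulmx0 !mul0mx !addr0.
  by rewrite Fe -!scalemxAr scalerA mulVf // scale1r wE.
have [||B UB CE] := @unitary_fix_delta _ n (F ^t* *m W ^t* *m A *m V *m F).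
- by rewrite !mul_unitarymx ?trmxC_unitary.
(* The path of e_0: F e_0 = s 1, V 1 = v, A v = w, W^* w = 1, F^* 1 = s^-1 e_0. *)
- rewrite -!mulmxA Fe -!scalemxAr vE Avw -[in X in W ^t* *m X]wE.
  by rewrite [W ^t* *m _]mulmxA unitarymx_adjoint_mul // mul1mx F1 scalerA divff // scale1r.
exists B => //; rewrite -CE !mulmxA.
by rewrite !mulmxtVK // (unitarymxP UW) mul1mx.
Qed.
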